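(* The universal Urysohn metric space $\mathbb{U}$ does not admit a coarse embedding into a superreflexive Banach space, and the integer-valued Urysohn space $\mathbb{U}_{\mathbb{Z}}$ does not admit a coarse embedding into a superreflexive Banach space.
   Context: The universal Urysohn metric space $\mathbb{U}$ is the complete separable metric space, unique up to isometry, which contains an isometric copy of every separable metric space and is ultrahomogeneous, that is, every isometry between two finite subspaces extends to a global self-isometry of the space. The integer-valued Urysohn space $\mathbb{U}_{\mathbb{Z}}$ is the analogous space, unique up to isometry, with all distances integer: a complete separable (hence countable) ultrahomogeneous metric space with integer distances containing an isometric copy of every separable (countable) metric space with integer distances. A coarse embedding of a metric space $X$ into a metric space $Y$ is a (not necessarily continuous) function $f\colon X\to Y$ such that for some non-decreasing, unbounded functions $\rho_1,\rho_2\colon\mathbb{R}_+\to\mathbb{R}_+$ with $\rho_1\le\rho_2$ one has, for all $x,y\in X$, $\rho_1(d_X(x,y))\le d_Y(f(x),f(y))\le\rho_2(d_X(x,y))$. A Banach space is superreflexive if every Banach space ultrapower of it is a reflexive Banach space (equivalently, if it admits an equivalent uniformly convex norm). Given an ultrafilter $\xi$ on a set $A$, the Banach space ultrapower of $E$ along $\xi$ is the quotient of the space of all bounded families $(y_\alpha)_{\alpha\in A}$ in $E$, equipped with the seminorm $\lim_{\alpha\to\xi}\|y_\alpha\|$, by the subspace of families of seminorm zero. *)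

(* Defs.v *)
From HB Require Import structures.
From mathcomp Require Import all_boot all_order all_algebra.
From mathcomp Require Import generic_quotient.
From mathcomp Require Import all_classical all_reals all_analysis.

Set Implicit Arguments.
Unset Strict Implicit.
Unset Printing Implicit Defensive.

Import Order.TTheory GRing.Theory Num.Def Num.Theory.
Import numFieldNormedType.Exports.

Local Open Scope classical_set_scope.
Local Open Scope ring_scope.

Section Dual.
Context {R : realType} {E : normedModType R}.

Definition dual_pred : {pred E -> R^o} :=
  [pred f : E -> R^o | `[< linear f /\ continuous f >]].

Lemma dual_predP (f : E -> R^o) :
  reflect (linear f /\ continuous f) (f \in dual_pred).
Proof. by rewrite inE; exact: asboolP. Qed.

Lemma dual_submod_closed : submod_closed dual_pred.
Proof.
split.
  apply/dual_predP; split; last exact: cst_continuous.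
  by move=> a u v /=; rewrite scaler0 addr0.
move=> a f g /dual_predP[lf cf] /dual_predP[lg cg]; apply/dual_predP; split.
  move=> b u v /=.
  rewrite [LHS]/(a *: f (b *: u + v) + g (b *: u + v)) lf lg.
  rewrite [RHS]/(b *: (a *: f u + g u) + (a *: f v + g v)).
  by rewrite !scalerDr !scalerA (mulrC a b); exact: addrACA.
move=> x; suff : a *: f y + g y @[y --> x] --> a *: f x + g x by [].
by apply: cvgD; [apply: cvgZl_tmp; exact: cf|exact: cg].
Qed.

HB.instance Definition _ :=
  GRing.isSubmodClosed.Build R (E -> R^o) dual_pred dual_submod_closed.

Record dual := Dual { dual_fun :> E -> R^o ; dual_funP : dual_fun \in dual_pred }.

HB.instance Definition _ := [isSub for dual_fun].
HB.instance Definition _ := [Choice of dual by <:].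
HB.instance Definition _ := [SubChoice_isSubLmodule of dual by <:].

Definition dual_norm (f : dual) : R :=
  sup [set `|f x| | x in [set x : E | `|x| <= 1]].

Lemma dual_linear (f : dual) : linear f.
Proof. by have /dual_predP[] := dual_funP f. Qed.

Lemma dual_addE (f g : dual) x : (f + g) x = f x + g x.
Proof. by []. Qed.

Lemma dual_scaleE a (f : dual) x : (a *: f) x = a *: f x.
Proof. by []. Qed.

Lemma dual_has_sup (f : dual) :
  has_sup [set `|f x| | x in [set x : E | `|x| <= 1]].
Proof.
split; first by exists `|f 0|; exists 0 => //=; rewrite normr0.
have [lf cf] := dual_predP _ (dual_funP f).
pose lin := GRing.isLinear.Build R E R^o *:%R (dual_fun f) lf.
pose g : {linear E -> R^o} := HB.pack (dual_fun f) lin.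
have bg : bounded_near g (nbhs 0) by exact/linear_bounded_continuous.
have [M gM] := (bounded_funP g).2 bg 1.
by exists M => _ [x /= x1 <-]; exact: gM.
Qed.

Lemma dual_norm_ge (f : dual) x : `|x| <= 1 -> `|f x| <= dual_norm f.
Proof.
by move=> x1; apply: sup_upper_bound; [exact: dual_has_sup|exists x].
Qed.

Lemma dual_norm_le (f : dual) M :
  (forall x, `|x| <= 1 -> `|f x| <= M) -> dual_norm f <= M.
Proof.
by move=> fM; apply: ge_sup => [|_ [x x1 <-]]; [have [] := dual_has_sup f|exact: fM].
Qed.

Lemma dual_normD f g : dual_norm (f + g) <= dual_norm f + dual_norm g.
Proof.
apply: dual_norm_le => x x1; rewrite dual_addE.
by rewrite (le_trans (ler_normD _ _))// lerD// dual_norm_ge.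
Qed.

Lemma dual_normZ_le a f : dual_norm (a *: f) <= `|a| * dual_norm f.
Proof.
apply: dual_norm_le => x x1; rewrite dual_scaleE normrZ.
by rewrite ler_wpM2l// dual_norm_ge.
Qed.

Lemma dual_norm_ge0 f : 0 <= dual_norm f.
Proof. by apply: le_trans (@dual_norm_ge f 0 _); rewrite ?normr0. Qed.

Lemma dual_normZ a f : dual_norm (a *: f) = `|a| * dual_norm f.
Proof.
apply/eqP; rewrite eq_le dual_normZ_le/=.
have [->|a0] := eqVneq a 0; first by rewrite normr0 mul0r dual_norm_ge0.
rewrite mulrC -ler_pdivlMr ?normr_gt0// mulrC -normfV.
by apply: le_trans (dual_normZ_le _ _); rewrite scalerA mulVf// scale1r.
Qed.

Lemma dual_norm0_eq0 f : dual_norm f = 0 -> f = 0.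
Proof.
move=> f0; apply/val_inj/funext => x /=.
have lf := dual_linear f.
have fZ b u : f (b *: u) = b *: f u.
  have f00 : f 0 = 0.
    have := lf 1 0 0; rewrite !scale1r addr0 => /eqP.
    by rewrite -subr_eq0 opprD addrA subrr sub0r oppr_eq0 => /eqP.
  by have := lf b u 0; rewrite !addr0 f00 addr0.
have [->|x0] := eqVneq x 0.
  by have := fZ 0 0; rewrite !scale0r.
have : `|f (`|x|^-1 *: x)| <= 0.
  rewrite -f0; apply: dual_norm_ge.
  by rewrite normrZ normfV normr_id mulVf// normr_eq0.
rewrite fZ normr_le0 scaler_eq0 invr_eq0 normr_eq0 (negbTE x0)/=.
by move=> /eqP.
Qed.

HB.instance Definition _ :=
  Lmodule_isNormed.Build R dual dual_normD dual_normZ dual_norm0_eq0.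

End Dual.
Arguments dual {R} E.

(* Surjectivity of the canonical embedding of E into its bidual. Completeness
   of E is not required: it follows, since a dual space is always complete. *)
Definition reflexive_space {R : realType} (E : normedModType R) : Prop :=
  forall phi : dual (dual E), exists x : E, forall f : dual E, phi f = f x.

Section BoundedFamilies.
Context {R : realType} (A : Type) (E : normedModType R).

Definition bounded_family_pred : {pred A -> E} :=
  [pred y : A -> E | `[< exists M, forall a, `|y a| <= M >]].

Lemma bounded_family_predP (y : A -> E) :
  reflect (exists M, forall a, `|y a| <= M) (y \in bounded_family_pred).
Proof. by rewrite inE; exact: asboolP. Qed.

Lemma bounded_family_submod_closed : submod_closed bounded_family_pred.
Proof.
split; first by apply/bounded_family_predP; exists 0 => a; rewrite normr0.
move=> c y z /bounded_family_predP[M yM] /bounded_family_predP[N zN].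
apply/bounded_family_predP; exists (`|c| * M + N) => a.
rewrite [X in `|X|]/(c *: y a + z a) (le_trans (ler_normD _ _))// normrZ.
by rewrite lerD// ler_wpM2l.
Qed.

HB.instance Definition _ := GRing.isSubmodClosed.Build R (A -> E)
  bounded_family_pred bounded_family_submod_closed.

Record bounded_family := BoundedFamily {
  family_fun :> A -> E ; family_funP : family_fun \in bounded_family_pred }.

HB.instance Definition _ := [isSub for family_fun].
HB.instance Definition _ := [Choice of bounded_family by <:].
HB.instance Definition _ := [SubChoice_isSubLmodule of bounded_family by <:].

End BoundedFamilies.

Section Ultrapower.
Context {R : realType} {A : Type} (xi : set_system A) {xiU : UltraFilter xi}
  (E : normedModType R).
Local Notation family := (bounded_family A E).

Definition ultra_seminorm (y : family) : R := lim (`|y a| @[a --> xi]).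

Lemma ultra_seminorm_cvg (y : family) : `|y a| @[a --> xi] --> ultra_seminorm y.
Proof.
have [M yM] := bounded_family_predP _ (family_funP y).
have := @segment_compact R 0 M; rewrite compact_ultra => cpt.
suff [l [_ yl]] : `[0, M]%classic `&` [set l | `|y a| @[a --> xi] --> l] !=set0.
  by apply/cvg_ex; exists l.
have xiy : UltraFilter (`|y a| @[a --> xi]).
  split=> [|G GF xiG]; first exact: fmap_proper_filter.
  apply/seteqP; split=> // B GB.
  have [//|xiB] := in_ultra_setVsetC ((fun a => `|y a|) @^-1` B) xiU.
  have GC : G (~` B) by exact: xiG.
  have := @filter_not_empty _ G _; rewrite -(setICr B) => /(_ _)[].
  exact: filterI.
apply: cpt => /=; near=> a => /=.
by rewrite in_itv/= normr_ge0 yM.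
Unshelve. all: by end_near. Qed.

Lemma ultra_seminorm_eq (y : family) l :
  `|y a| @[a --> xi] --> l -> ultra_seminorm y = l.
Proof. by move=> yl; apply/cvg_lim. Qed.

Lemma ultra_seminormD y z :
  ultra_seminorm (y + z) <= ultra_seminorm y + ultra_seminorm z.
Proof.
rewrite -subr_ge0.
have yz : `|y a| + `|z a| - `|(y + z) a| @[a --> xi] -->
    ultra_seminorm y + ultra_seminorm z - ultra_seminorm (y + z).
  by apply: cvgB; [apply: cvgD|]; exact: ultra_seminorm_cvg.
apply: (cvgr_to_ge yz); near=> a.
by rewrite subr_ge0; exact: ler_normD.
Unshelve. all: by end_near. Qed.

Lemma ultra_seminormZ c y : ultra_seminorm (c *: y) = `|c| * ultra_seminorm y.
Proof.
apply: ultra_seminorm_eq.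
rewrite (_ : (fun _ => _) = (fun a => `|c| * `|y a|)); last first.
  by apply/funext => a; exact: normrZ.
by apply: cvgMl_tmp; exact: ultra_seminorm_cvg.
Qed.

Lemma ultra_seminorm_ge0 y : 0 <= ultra_seminorm y.
Proof.
apply: limr_ge; last by near=> a.
by apply/cvg_ex; exists (ultra_seminorm y); exact: ultra_seminorm_cvg.
Unshelve. all: by end_near. Qed.

Definition null_family : {pred family} :=
  [pred y : family | ultra_seminorm y == 0].

Lemma null_family_submod_closed : submod_closed null_family.
Proof.
split; first by rewrite inE -(scale0r 0) ultra_seminormZ normr0 mul0r.
move=> c y z; rewrite !inE => /eqP y0 /eqP z0.
rewrite eq_le ultra_seminorm_ge0 andbT (le_trans (ultra_seminormD _ _))//.
by rewrite ultra_seminormZ y0 z0 mulr0 addr0.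
Qed.

HB.instance Definition _ := GRing.isSubmodClosed.Build R family
  null_family null_family_submod_closed.

Definition ultrapower : Type := Quotient.quot null_family.

HB.instance Definition _ := GRing.Zmodule.on ultrapower.
HB.instance Definition _ := EqQuotient.on ultrapower.

Local Open Scope quotient_scope.
Local Notation class y := (\pi_ultrapower y).

Lemma ultrapower_eqP (y z : family) :
  reflect (class y = class z) (y - z \in null_family).
Proof. by rewrite Quotient.idealrBE; exact: eqP. Qed.

Lemma ultrapower_reprE (u : ultrapower) : class (repr u) = u.
Proof. exact: reprK. Qed.

Lemma ultrapowerD y z : class (y + z) = class y + class z.
Proof. exact: Quotient.pi_add. Qed.

Lemma ultrapower0 : class 0 = 0.
Proof. by apply/esym; rewrite [LHS]piE. Qed.

Definition ultrapower_scale (c : R) (u : ultrapower) : ultrapower :=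
  class (c *: repr u).

Lemma ultrapowerZ c y : class (c *: y) = ultrapower_scale c (class y).
Proof.
apply/ultrapower_eqP; rewrite -scalerBr rpredZ//.
by apply/ultrapower_eqP; rewrite ultrapower_reprE.
Qed.

Lemma ultrapower_scaleA a b u :
  ultrapower_scale a (ultrapower_scale b u) = ultrapower_scale (a * b) u.
Proof. by rewrite -(ultrapower_reprE u) -!ultrapowerZ scalerA. Qed.

Lemma ultrapower_scale1 : left_id 1 ultrapower_scale.
Proof.
by move=> u; rewrite -(ultrapower_reprE u) -!ultrapowerZ scale1r.
Qed.

Lemma ultrapower_scaleDr : right_distributive ultrapower_scale +%R.
Proof.
move=> c u v; rewrite -(ultrapower_reprE u) -(ultrapower_reprE v).
by rewrite -ultrapowerD -!ultrapowerZ scalerDr ultrapowerD.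
Qed.

Lemma ultrapower_scaleDl u : {morph ultrapower_scale^~ u : a b / a + b}.
Proof.
move=> a b; rewrite -(ultrapower_reprE u).
by rewrite -!ultrapowerZ scalerDl ultrapowerD.
Qed.

HB.instance Definition _ := GRing.Zmodule_isLmodule.Build R ultrapower
  ultrapower_scaleA ultrapower_scale1 ultrapower_scaleDr ultrapower_scaleDl.

Definition ultrapower_norm (u : ultrapower) : R := ultra_seminorm (repr u).

Lemma ultrapower_normE y : ultrapower_norm (class y) = ultra_seminorm y.
Proof.
have le_seminorm (v w : family) :
    class v = class w -> ultra_seminorm v <= ultra_seminorm w.
  move=> /ultrapower_eqP; rewrite inE => /eqP vw0.
  by rewrite -[v](subrK w) (le_trans (ultra_seminormD _ _))// vw0 add0r.
by apply/eqP; rewrite eq_le !le_seminorm// ultrapower_reprE.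
Qed.

Lemma ultrapower_normD u v :
  ultrapower_norm (u + v) <= ultrapower_norm u + ultrapower_norm v.
Proof.
rewrite -(ultrapower_reprE u) -(ultrapower_reprE v).
by rewrite -ultrapowerD !ultrapower_normE ultra_seminormD.
Qed.

Lemma ultrapower_normZ (c : R) (u : ultrapower) :
  ultrapower_norm (c *: u) = `|c| * ultrapower_norm u.
Proof. by rewrite ultrapower_normE ultra_seminormZ. Qed.

Lemma ultrapower_norm0_eq0 u : ultrapower_norm u = 0 -> u = 0.
Proof.
move=> u0; rewrite -(ultrapower_reprE u) -ultrapower0.
by apply/ultrapower_eqP; rewrite subr0 inE; exact/eqP.
Qed.

HB.instance Definition _ := Lmodule_isNormed.Build R ultrapower
  ultrapower_normD ultrapower_normZ ultrapower_norm0_eq0.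

End Ultrapower.

Definition superreflexive {R : realType} (E : completeNormedModType R) : Prop :=
  forall (A : Type) (xi : set_system A) (xiU : UltraFilter xi),
    reflexive_space (@ultrapower R A xi xiU E).

Section Urysohn.
Context {R : realType}.
Implicit Types X Y : metricType R.

Definition complete_metric X : Prop :=
  forall F : set_system X, ProperFilter F -> cauchy F -> exists x : X, F --> x.

Definition separable X : Prop :=
  exists2 D : set X, countable D & dense D.

Definition isometric_embedding X Y (f : X -> Y) : Prop :=
  forall x x', mdist (f x) (f x') = mdist x x'.

(* The isometry from A onto B is the restriction of g to A; g is arbitrary
   outside A. *)
Definition ultrahomogeneous X : Prop :=
  forall (A B : set X) (g : X -> X), finite_set A -> finite_set B ->
    g @` A = B ->
    {in A &, forall x x', mdist (g x) (g x') = mdist x x'} ->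
    exists h : X -> X,
      [/\ isometric_embedding h, bijective h & {in A, h =1 g}].

Definition integer_distances X : Prop :=
  forall x x' : X, mdist x x' \is a Num.int.

Definition urysohn_space X : Prop :=
  [/\ complete_metric X, separable X, ultrahomogeneous X
    & forall Y, separable Y -> exists f : Y -> X, isometric_embedding f].

Definition integer_urysohn_space X : Prop :=
  [/\ complete_metric X, separable X, ultrahomogeneous X, integer_distances X
    & forall Y, separable Y -> integer_distances Y ->
        exists f : Y -> X, isometric_embedding f].

End Urysohn.

(* A function from R_+ to R_+, given by a function on R whose values on
   negative reals are irrelevant, that is non-decreasing and unbounded. *)
Definition control_function {R : realType} (rho : R -> R) : Prop :=
  [/\ forall t : R, 0 <= t -> 0 <= rho t,
      forall s t : R, 0 <= s -> s <= t -> rho s <= rho t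
    & forall M : R, exists2 t : R, 0 <= t & M < rho t].

Definition coarse_embedding {R : realType} {X : metricType R}
    {E : normedModType R} (f : X -> E) : Prop :=
  exists rho1 rho2 : R -> R,
    [/\ control_function rho1, control_function rho2,
        forall t : R, 0 <= t -> rho1 t <= rho2 t
      & forall x y, rho1 (mdist x y) <= `|f x - f y| <= rho2 (mdist x y)].

(* Main.v *)
From HB Require Import structures.
Require Import Defs.
From mathcomp Require Import all_boot all_order all_algebra.
From mathcomp Require Import all_classical all_reals all_analysis.
From mathcomp Require Import zify lra.

Set Implicit Arguments.
Unset Strict Implicit.
Unset Printing Implicit Defensive.

Import Order.TTheory GRing.Theory Num.Def Num.Theory.
Import numFieldNormedType.Exports.

Local Open Scope classical_set_scope.
Local Open Scope ring_scope.

(** Superreflexivity enters only through the reflexivity of one ultrapower,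
    which contains an isometric copy of the space: a coarse embedding into a
    superreflexive space yields one into a reflexive space. On the other side,
    both Urysohn spaces contain the countable space of finitely supported
    integer sequences with the supremum distance ([integer_c00]). What has to be
    shown is thus an instance of a theorem of Kalton: that space does not embed
    coarsely into a reflexive space [E] ([integer_c00_not_coarse]).

    Send a list [s] of [r] natural numbers to the sequence whose [k]-th entry
    counts the elements of [s] larger than [k] ([staircase]). If [s] and [t]
    interlace, the images are at distance at most 1; if all of [t] lies beyond
    [s], their distance is at least [r]. Let [F s] be the point of [E]
    associated with [s]; interlacing lists then satisfy
    [norm (F s - F t) <= C] for a [C] that does not depend on [r].

    Fix a nonprincipal ultrafilter on [nat] and take limits of functions
    of [s] along it in the [r] entries successively, the last entry being the
    innermost limit. By reflexivity the weak iterated limit of [F] is a vector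
    [y] of [E]. Choose functionals [g s] of norm at most 1 with
    [g s (F s - y) = norm (F s - y)], and let [gam] be the weak-* iterated
    limit of [g]. For interlacing lists [g s (F s) - g s (F t) <= C]. Taking
    the limits in the interlaced order, from the largest entry to the smallest,
    turns [g s (F s)] into its iterated limit and [g s (F t)] into [gam y],
    since every single limit concerns only one of the two arguments of the
    pairing ([interlaced_limit]). Hence the iterated limit of
    [norm (F s - y) = g s (F s) - g s y] is at most [C]
    ([interlaced_concentration]). So there are [s] and, beyond it, [t] such that
    [F s] and [F t] are within [C + 1] of [y]. Their mutual distance is at most
    [2 * C + 2] whereas the points they come from are at distance at least [r],
    which is arbitrary: the embedding is not coarse.

    The norming functionals come from the Hahn-Banach theorem, obtained here by
    applying Zorn's lemma to sublinear functionals: the minimal ones are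
    linear. *)

(** * The Hahn-Banach theorem through minimal sublinear functionals *)

Section Sublinear.
Context {R : realType} {E : lmodType R}.
Implicit Types p q : E -> R.

(** Positive homogeneity is asked as an inequality, which is easier to verify
    for an infimum; used for [c] and for its inverse it gives equality. *)
Definition sublinear p : Prop :=
  (forall x y, p (x + y) <= p x + p y) /\
  (forall c x, 0 < c -> p (c *: x) <= c * p x).

Lemma sublinearZ p c x : sublinear p -> 0 < c -> p (c *: x) = c * p x.
Proof.
move=> [_ pZ] c0; apply/eqP; rewrite eq_le pZ//= mulrC -ler_pdivlMr// mulrC.
apply: le_trans (pZ _ _ _); rewrite ?invr_gt0//.
by rewrite scalerA mulVf ?gt_eqF// scale1r.
Qed.

Lemma sublinear0 p : sublinear p -> p 0 = 0.
Proof.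
by move=> sp; have := sublinearZ 0 sp (ltr0Sn R 1); rewrite scaler0; lra.
Qed.

Lemma sublinear_geN p x : sublinear p -> - p (- x) <= p x.
Proof.
move=> sp; have := sp.1 x (- x); rewrite subrr sublinear0//.
by rewrite -lerBlDr sub0r.
Qed.

(** The infimum of a family is sublinear as soon as the family is directed in
    the two ways needed to compare infima; both chains of sublinear
    functionals and the family that defines [shift] below are of this form. *)
Lemma sublinear_inf I (D : set I) (F : I -> E -> R) (m : E -> R) :
  D !=set0 -> (forall i x, D i -> m x <= F i x) ->
  (forall i j x y, D i -> D j ->
     exists2 k, D k & F k (x + y) <= F i x + F j y) ->
  (forall i c x, D i -> 0 < c -> exists2 k, D k & F k (c *: x) <= c * F i x) ->
  let q x := inf [set F i x | i in D] in
  sublinear q /\ forall i x, D i -> q x <= F i x.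
Proof.
move=> [i0 Di0] mF FD FZ q.
have qF i x : D i -> q x <= F i x.
  move=> Di; apply: ge_inf; last by exists i.
  by exists (m x) => _ [j Dj <-]; exact: mF.
have q_ge x b : (forall i, D i -> b <= F i x) -> b <= q x.
  move=> bF; apply: lb_le_inf; first by exists (F i0 x), i0.
  by move=> _ [j Dj <-]; exact: bF.
split=> //; split=> [x y|c x c0].
  rewrite -lerBlDr; apply: (q_ge) => i Di.
  rewrite lerBlDr -lerBlDl; apply: (q_ge) => j Dj.
  rewrite lerBlDl; have [k Dk] := FD i j x y Di Dj.
  by apply: le_trans; exact: qF.
rewrite mulrC -ler_pdivrMr//; apply: (q_ge) => i Di.
rewrite ler_pdivrMr// mulrC; have [k Dk] := FZ i c x Di c0.
by apply: le_trans; exact: qF.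
Qed.

(** The largest sublinear functional below [p] whose value at [- y] is at most
    [- p y]: lowering [p] to it makes [p] odd at [y]. *)
Definition shift p y x : R :=
  inf [set p (x + t *: y) - t * p y | t in [set t : R | 0 <= t]].

Lemma shift_sublinear p y : sublinear p ->
  [/\ sublinear (shift p y), forall x, shift p y x <= p x
    & shift p y (- y) <= - p y].
Proof.
move=> sp.
have pZ t x : 0 <= t -> p (t *: x) = t * p x.
  rewrite le_eqVlt => /predU1P[<-|t0]; last exact: sublinearZ.
  by rewrite scale0r mul0r sublinear0.
have [] := @sublinear_inf R [set t : R | 0 <= t]
  (fun t x => p (x + t *: y) - t * p y) (fun x => - p (- x)).
- by exists 0 => /=.
- move=> t x /= t0; rewrite lerBrDr -pZ// addrC lerBlDr.
  by apply: le_trans (sp.1 _ _); rewrite addrAC subrr add0r.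
- move=> s t x z /= s0 t0; exists (s + t); first exact: addr_ge0.
  rewrite scalerDl addrACA (le_trans (lerB (sp.1 _ _) (lexx _)))//.
  by rewrite mulrDl opprD addrACA.
- move=> t c x /= t0 c0; exists (c * t); first by rewrite mulr_ge0// ltW.
  by rewrite -scalerA -scalerDr sublinearZ// mulrBr mulrA.
move=> ss sle; split=> // [x|].
  by have := sle 0 x (lexx _); rewrite scale0r addr0 mul0r subr0.
have := sle 1 (- y) ler01.
by rewrite scale1r addNr sublinear0// sub0r mul1r.
Qed.

Lemma minimal_sublinear P : sublinear P ->
  exists q, [/\ sublinear q, forall x, q x <= P x
    & forall q', sublinear q' -> (forall x, q' x <= q x) -> q' = q].
Proof.
move=> sP; pose T := {q : E -> R | sublinear q /\ forall x, q x <= P x}.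
pose below (q q' : T) : bool := `[< forall x, sval q' x <= sval q x >].
have [| | | |[q [sq qP]] /= qmin] := @Zorn T below.
- by move=> q; apply/asboolP.
- move=> q1 q2 q3 /asboolP q12 /asboolP q23; apply/asboolP => x.
  exact: le_trans (q23 x) (q12 x).
- move=> [q1 h1] [q2 h2] /asboolP q12 /asboolP q21; apply: eq_exist.
  by apply/funext => x; apply/eqP; rewrite eq_le q12 q21.
- move=> A Atot; have [[q0 Aq0]|A0] := pselect (A !=set0); last first.
    by exists (exist _ P (conj sP (fun=> lexx _))) => q Aq; case: A0; exists q.
  have [] := @sublinear_inf T A (fun s : T => sval s) (fun x => - P (- x)).
  + by exists q0.
  + move=> [q [sq qP]] x _ /=; apply: le_trans (sublinear_geN _ sq).
    by rewrite lerN2.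
  + move=> q q' x y Aq Aq'; have [/asboolP qq'|/asboolP qq'] := Atot _ _ Aq Aq'.
      exists q' => //; rewrite (le_trans ((svalP q').1.1 _ _))//.
      by rewrite lerD2r.
    exists q => //; rewrite (le_trans ((svalP q).1.1 _ _))//.
    by rewrite lerD2l.
  + by move=> q c x Aq c0; exists q => //; exact: (svalP q).1.2.
  move=> sI leI.
  pose I x := inf [set sval i x | i in A].
  have IP x : I x <= P x := le_trans (leI q0 x Aq0) ((svalP q0).2 x).
  exists (exist _ I (conj sI IP)).
  by move=> q Aq; apply/asboolP => x; exact: leI.
exists q; split=> // q' sq' q'q.
have q'P x : q' x <= P x by exact: le_trans (q'q x) (qP x).
have := qmin (exist _ q' (conj sq' q'P)).
by move=> /(_ (asboolT q'q)) [].
Qed.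

(** Minimality forces [shift q y = q], so that a minimal [q] is odd, and an odd
    sublinear functional is linear. *)
Lemma linear_below_sublinear P : sublinear P ->
  exists2 q : E -> R^o, linear q & forall x, q x <= P x.
Proof.
move=> /minimal_sublinear[q [sq qP qmin]]; exists q => //.
have qN y : q (- y) = - q y.
  have [ss sle sy] := shift_sublinear y sq.
  move: sy; rewrite (qmin _ ss sle) => qy; apply/eqP; rewrite eq_le qy/=.
  by rewrite lerNl sublinear_geN.
have qD x y : q (x + y) = q x + q y.
  apply/eqP; rewrite eq_le sq.1/= -[q y]opprK -qN lerBlDr.
  by have := sq.1 (x + y) (- y); rewrite addrK.
have qZ c x : q (c *: x) = c * q x.
  have [c0|c0|<-] := ltrgtP 0 c; first exact: sublinearZ.
    rewrite -[c *: x]opprK -scaleNr qN sublinearZ ?oppr_gt0//.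
    by rewrite mulNr opprK.
  by rewrite scale0r mul0r sublinear0.
by move=> c x y; rewrite qD qZ.
Qed.

End Sublinear.

Section Functionals.
Context {R : realType}.

Lemma dual_of_bounded (E : normedModType R) (f : E -> R^o) M :
  linear f -> (forall x, `|f x| <= M * `|x|) ->
  exists g : dual E, forall x, g x = f x.
Proof.
move=> lf fM.
pose lin := GRing.isLinear.Build R E R^o *:%R f lf.
pose h : {linear E -> R^o} := HB.pack f lin.
suff cf : continuous f by exists (Dual (introT (dual_predP f) (conj lf cf))).
apply/(linear_bounded_continuous h)/bounded_funP => r; exists (`|M| * r) => x xr.
rewrite (le_trans (fM x))// (le_trans (ler_wpM2r (normr_ge0 x) (ler_norm M)))//.
exact: ler_wpM2l.
Qed.

Variable E : normedModType R.
Implicit Types (f : dual E) (x : E).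

Lemma dualD f x y : f (x + y) = f x + f y.
Proof. by have := dual_linear f 1 x y; rewrite !scale1r. Qed.

Lemma dual0 f : f 0 = 0.
Proof. by have := dualD f 0 0; rewrite addr0 => h; lra. Qed.

Lemma dualZ f (c : R) x : f (c *: x) = c * f x.
Proof. by have := dual_linear f c x 0; rewrite !addr0 dual0 addr0. Qed.

Lemma dualB f x y : f (x - y) = f x - f y.
Proof. by rewrite dualD -scaleN1r dualZ mulN1r. Qed.

Lemma le_dual_norm f x : `|f x| <= dual_norm f * `|x|.
Proof.
have [->|x0] := eqVneq x 0; first by rewrite dual0 !normr0 mulr0.
have n0 : 0 < `|x| by rewrite normr_gt0.
rewrite -ler_pdivrMr//.
have := @dual_norm_ge _ _ f (`|x|^-1 *: x).
rewrite normrZ normfV normr_id mulVf ?gt_eqF// => /(_ (lexx _)).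
by rewrite dualZ normrM normfV normr_id mulrC.
Qed.

(** A linear functional below [shift norm y] is below the norm and takes at
    [- y] a value at most [- norm y]. *)
Lemma norming_functional y :
  exists f : dual E, (forall x, `|f x| <= `|x|) /\ f y = `|y|.
Proof.
have sn : sublinear (fun x : E => `|x|).
  split=> [x z|c x c0]; first exact: ler_normD.
  by rewrite normrZ gtr0_norm.
have [ss sle sy] := shift_sublinear y sn.
have [q lq qle] := linear_below_sublinear ss.
have q_le x : q x <= `|x| by exact: le_trans (qle x) (sle x).
have qD x z : q (x + z) = q x + q z by have := lq 1 x z; rewrite !scale1r.
have q0 : q 0 = 0 by have := qD 0 0; rewrite addr0 => ?; lra.
have qN x : q (- x) = - q x by apply/eqP; rewrite -addr_eq0 -qD addNr q0.
have q_norm x : `|q x| <= `|x|.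
  by rewrite ler_norml q_le andbT lerNl -qN -[X in _ <= X]normrN q_le.
have [f fq] := @dual_of_bounded _ q 1 lq (fun x => ltac:(by rewrite mul1r)).
exists f; split=> [x|]; first by rewrite fq.
apply/eqP; rewrite fq eq_le q_le/= -lerN2 -qN.
exact: le_trans (qle _) sy.
Qed.

End Functionals.

(** * Iterated limits along an ultrafilter *)

Section IteratedLimits.
Context {R : realType} (U : set_system nat) {UU : UltraFilter U}.
Hypothesis U_gt : forall k, U [set n | (k < n)%N].
Implicit Types (u : nat -> R) (phi psi : seq nat -> R).

Lemma ultra_bounded_cvg u (M : R) :
  (forall n, `|u n| <= M) -> u n @[n --> U] --> lim (u n @[n --> U]).
Proof.
move=> uM; pose v n : R^o := u n + M.
have vM : v \in @bounded_family_pred R nat R^o.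
  apply/bounded_family_predP; exists (M + `|M|) => n.
  by rewrite (le_trans (ler_normD _ _))// lerD2r.
(* [u + M] is nonnegative, hence its own norm. *)
have -> : u = fun n => `|v n| - M.
  apply/funext => n; rewrite ger0_norm ?addrK//.
  by have := uM n; rewrite ler_norml /v => /andP[? _]; lra.
apply/cvg_ex; exists (ultra_seminorm U (BoundedFamily vM) - M).
by apply: cvgB; [exact: ultra_seminorm_cvg (BoundedFamily vM)|exact: cvg_cst].
Qed.

(** The first entry of the list is the variable of the outermost limit. *)
Fixpoint iterlim r phi : R :=
  if r is r'.+1 then lim (iterlim r' (fun s => phi (a :: s)) @[a --> U])
  else phi [::].

Lemma iterlim_norm_le r phi M :
  (forall s, `|phi s| <= M) -> `|iterlim r phi| <= M.
Proof.
elim: r phi => [|r IH] phi phiM /=; first exact: phiM.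
have phi_cvg := @ultra_bounded_cvg (fun a => iterlim r (fun s => phi (a :: s)))
  M (fun a => IH _ (fun s => phiM (a :: s))).
apply: (cvgr_to_le (cvg_norm phi_cvg)).
by near=> a; apply: IH => s; exact: phiM.
Unshelve. all: by end_near. Qed.

Lemma iterlim_cvg r phi M : (forall s, `|phi s| <= M) ->
  iterlim r (fun s => phi (a :: s)) @[a --> U] --> iterlim r.+1 phi.
Proof.
by move=> phiM; apply: (@ultra_bounded_cvg _ M) => a; exact: iterlim_norm_le.
Qed.

Lemma iterlim_linear r c phi psi M N :
  (forall s, `|phi s| <= M) -> (forall s, `|psi s| <= N) ->
  iterlim r (fun s => c * phi s + psi s) = c * iterlim r phi + iterlim r psi.
Proof.
elim: r phi psi => [//|r IH] phi psi phiM psiN.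
apply/cvg_lim => //.
rewrite (_ : (fun a => _) = fun a =>
    c * iterlim r (fun s => phi (a :: s)) + iterlim r (fun s => psi (a :: s))).
  apply: cvgD; last exact: iterlim_cvg psiN.
  by apply: cvgMl_tmp; exact: iterlim_cvg phiM.
by apply/funext => a; apply: IH => s; [exact: phiM|exact: psiN].
Qed.

Lemma iterlim_lt_exists r phi M c k : (forall s, `|phi s| <= M) ->
  iterlim r phi < c -> exists s, [/\ size s = r, path ltn k s & phi s < c].
Proof.
elim: r phi k => [|r IH] phi k phiM phic; first by exists [::].
have Ulim : U [set a | iterlim r (fun s => phi (a :: s)) < c].
  exact: (cvgr_lt _ (iterlim_cvg phiM)).
have [a [/= ka /(IH _ a)[|s [sr pas pc]]]] := filter_ex (filterI (U_gt k) Ulim).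
  by move=> s; exact: phiM.
by exists (a :: s); rewrite /= sr ka.
Qed.

Lemma iterlim_functional (V : normedModType R) (g : seq nat -> dual V) M r :
  (forall s x, `|g s x| <= M * `|x|) ->
  exists gam : dual V, forall x, gam x = iterlim r (fun s => g s x).
Proof.
move=> gM; apply: (dual_of_bounded (M := M)) => [c x z|x].
  rewrite -(iterlim_linear r c (gM^~ x) (gM^~ z)).
  by congr iterlim; apply/funext => s; rewrite dualD dualZ.
by apply: iterlim_norm_le.
Qed.

(** Iterated limits are taken in the bidual; reflexivity brings them back. *)
Lemma iterlim_vector (E : normedModType R) (F : seq nat -> E) M r :
  reflexive_space E -> (forall s, `|F s| <= M) ->
  exists y, forall f : dual E, f y = iterlim r (fun s => f (F s)).
Proof.
move=> reflE FM.
have fF (f : dual E) s : `|f (F s)| <= M * `|f|.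
  rewrite (le_trans (le_dual_norm f _))// mulrC ler_wpM2r//.
  exact: dual_norm_ge0.
have [|f|phi phiE] := @dual_of_bounded R (dual E)
    (fun f => iterlim r (fun s => f (F s))) M.
- by move=> c f g; rewrite -(iterlim_linear r c (fF f) (fF g)).
- exact: iterlim_norm_le.
by have [y phiy] := reflE phi; exists y => f; rewrite -phiy phiE.
Qed.

(** [s] and [t] interlace above [k]:
    [k < s_1 < t_1 < s_2 < t_2 < ... < s_r < t_r]. *)
Fixpoint interlaced k (s t : seq nat) : bool :=
  match s, t with
  | [::], [::] => true
  | a :: s', b :: t' => [&& (k < a)%N, (a < b)%N & interlaced b s' t']
  | _, _ => false
  end.

(** The inequality is integrated over interlacing pairs in the order
    [t_r, s_r, ..., t_1, s_1], innermost limit first.  Although [g s] and [F t]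
    converge only weakly, each single limit in this order moves only one of the
    two arguments of the pairing. *)
Lemma interlaced_limit (E : normedModType R) r k (h : seq nat -> R)
    (g : seq nat -> dual E) (F : seq nat -> E) (gam : dual E) (y : E) M C :
  reflexive_space E -> (forall s, `|h s| <= M) ->
  (forall s x, `|g s x| <= `|x|) -> (forall s, `|F s| <= M) ->
  (forall x, gam x = iterlim r (fun s => g s x)) ->
  (forall f : dual E, f y = iterlim r (fun s => f (F s))) ->
  (forall s t, size s = r -> interlaced k s t -> h s - g s (F t) <= C) ->
  iterlim r h - gam y <= C.
Proof.
move=> reflE; elim: r k h g F gam y => [|r IH] k h g F gam y hM gM FM gamE yE hC.
  by rewrite gamE /= yE; exact: hC.
have g1 a s x : `|g (a :: s) x| <= 1 * `|x| by rewrite mul1r.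
have /choice[gama gamaE] a := iterlim_functional r (g1 a).
have /choice[ya yaE] b := iterlim_vector r reflE (fun s => FM (b :: s)).
have step a b : (k < a < b)%N ->
    iterlim r (fun s => h (a :: s)) - gama a (ya b) <= C.
  move=> /andP[ka ab].
  apply: (IH b _ (fun s => g (a :: s)) (fun t => F (b :: t))) => //.
  by move=> s t sr st; apply: hC => /=; rewrite ?sr ?ka ?ab.
have fF (f : dual E) s : `|f (F s)| <= dual_norm f * M.
  by rewrite (le_trans (le_dual_norm f _))// ler_wpM2l// dual_norm_ge0.
have y_cvg (f : dual E) : f (ya b) @[b --> U] --> f y.
  rewrite (yE f); under eq_fun do rewrite yaE; exact: (iterlim_cvg (fF f)).
have outer a : (k < a)%N -> iterlim r (fun s => h (a :: s)) - gama a y <= C.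
  move=> ka.
  apply: (cvgr_to_le (cvgB (cvg_cst (iterlim r (fun s => h (a :: s))))
    (y_cvg (gama a)))).
  by apply: filterS (U_gt a) => b /= ab; apply: step; rewrite ka.
have gam_cvg : gama a y @[a --> U] --> gam y.
  rewrite (gamE y); under eq_fun do rewrite gamaE.
  exact: (iterlim_cvg (fun s => gM s y)).
apply: (cvgr_to_le (cvgB (iterlim_cvg hM) gam_cvg)).
by apply: filterS (U_gt k) => a; exact: outer.
Qed.

(** Let [y] be the iterated weak limit of [F] and [g s] a functional norming
    [F s - y]. The bound of the previous lemma, applied to
    [h s = g s (F s)], is then a bound for the norm of [F s - y], not merely for
    its weak limits. *)
Lemma interlaced_concentration (E : normedModType R) r (F : seq nat -> E) M C :
  reflexive_space E -> (forall s, `|F s| <= M) ->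
  (forall s t, size s = r -> interlaced 0 s t -> `|F s - F t| <= C) ->
  exists y, iterlim r (fun s => `|F s - y|) <= C.
Proof.
move=> reflE FM FC; have [y yE] := iterlim_vector r reflE FM; exists y.
have /choice[g] s := norming_functional (F s - y).
move=> /all_and2[g1 gF].
have g1M s x : `|g s x| <= 1 * `|x| by rewrite mul1r.
have [gam gamE] := iterlim_functional r g1M.
have gFM s : `|g s (F s)| <= M by exact: le_trans (g1 _ _) (FM s).
have gy s : `|g s y| <= `|y| by exact: g1.
have -> : iterlim r (fun s => `|F s - y|) =
    iterlim r (fun s => g s (F s)) - gam y.
  rewrite gamE addrC -mulN1r -(iterlim_linear r (-1) gy gFM).
  by congr iterlim; apply/funext => s; rewrite -gF dualB mulN1r addrC.
apply: (interlaced_limit (k := 0) reflE gFM g1 FM gamE yE) => s t sr st.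
rewrite -dualB (le_trans (ler_norm _))//.
by rewrite (le_trans (g1 _ _))// FC.
Qed.

Lemma interlaced_far_pair (E : normedModType R) r (F : seq nat -> E) M C :
  reflexive_space E -> (forall s, `|F s| <= M) ->
  (forall s t, size s = r -> interlaced 0 s t -> `|F s - F t| <= C) ->
  exists s t, [/\ size s = r, size t = r, path ltn 0 (s ++ t)
    & `|F s - F t| <= 2 * C + 2].
Proof.
move=> reflE FM FC; have [y yC] := interlaced_concentration reflE FM FC.
have FyM s : `| `|F s - y| | <= M + `|y|.
  by rewrite normr_id (le_trans (ler_normB _ _))// lerD2r.
(* A strict bound on an iterated limit is attained by actual lists. *)
have {}yC : iterlim r (fun s => `|F s - y|) < C + 1.
  by rewrite (le_lt_trans yC)// ltrDl.
have [s [sr ps sy]] := iterlim_lt_exists 0 FyM yC.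
have [t [tr pt ty]] := iterlim_lt_exists (last 0%N s) FyM yC.
exists s, t; split=> //; first by rewrite cat_path ps.
have -> : F s - F t = (F s - y) - (F t - y) by rewrite opprB addrA subrK.
by rewrite (le_trans (ler_normB _ _))//; lra.
Qed.

End IteratedLimits.

(** * Integer sequences with the supremum distance *)

Section SupNorm.
Implicit Types p q : {poly int}.

Definition sup_norm p : nat := \max_(i < size p) absz (p`_i)%R.

Lemma coef_le_sup_norm p i : (absz (p`_i)%R <= sup_norm p)%N.
Proof.
have [ip|pi] := ltnP i (size p); last by rewrite nth_default.
exact: (leq_bigmax (Ordinal ip)).
Qed.

Lemma sup_norm_le p n : (forall i, (absz (p`_i)%R <= n)%N) -> (sup_norm p <= n)%N.
Proof. by move=> pn; apply/bigmax_leqP => i _. Qed.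

Lemma sup_norm0 : sup_norm 0 = 0%N.
Proof. by rewrite /sup_norm size_poly0 big_ord0. Qed.

Lemma sup_norm_eq0 p : sup_norm p = 0%N -> p = 0.
Proof.
move=> p0; apply/polyP => i; apply/eqP; rewrite coef0 -absz_eq0 -leqn0 -p0.
exact: coef_le_sup_norm.
Qed.

Lemma sup_normN p : sup_norm (- p) = sup_norm p.
Proof.
rewrite /sup_norm size_polyN; apply: eq_bigr => i _.
by rewrite coefN abszN.
Qed.

Lemma sup_normD p q : (sup_norm (p + q)%R <= sup_norm p + sup_norm q)%N.
Proof.
apply: sup_norm_le => i; rewrite coefD.
by have := coef_le_sup_norm p i; have := coef_le_sup_norm q i; lia.
Qed.

End SupNorm.

(** Finitely supported integer sequences, encoded by polynomials to inherit
    their group structure and countability. The field [R] is a parameter of the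
    type so that the instances below can be found from the type alone. *)
Definition integer_c00 (R : realType) : Type := {poly int}.

Section IntegerC00.
Context {R : realType}.

HB.instance Definition _ := Countable.on (integer_c00 R).

Definition sup_dist (p q : integer_c00 R) : R :=
  (sup_norm ((p : {poly int}) - q))%:R.

Lemma sup_distxx p : sup_dist p p = 0.
Proof. by rewrite /sup_dist subrr sup_norm0. Qed.

Lemma sup_dist_eq0 p q : sup_dist p q = 0 -> p = q.
Proof.
move/eqP; rewrite pnatr_eq0 => /eqP/sup_norm_eq0/eqP.
by rewrite subr_eq0 => /eqP.
Qed.

Lemma sup_distC p q : sup_dist p q = sup_dist q p.
Proof. by rewrite /sup_dist -sup_normN opprB. Qed.

Lemma sup_dist_triangle q p s : sup_dist p s <= sup_dist p q + sup_dist q s.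
Proof.
rewrite /sup_dist -natrD ler_nat.
by rewrite -[X in sup_norm X](subrKA (q : {poly int})) sup_normD.
Qed.

HB.instance Definition _ := isMetric.Build R (integer_c00 R)
  sup_distxx sup_dist_eq0 sup_distC sup_dist_triangle.

Lemma mdist_integer_c00E (p q : {poly int}) :
  mdist (p : integer_c00 R) (q : integer_c00 R) = (sup_norm (p - q))%:R.
Proof. by []. Qed.

Lemma integer_c00_separable : separable (integer_c00 R).
Proof.
exists setT; last by move=> O [p Op] _; exists p.
exact: countableP.
Qed.

Lemma integer_c00_distances : integer_distances (integer_c00 R).
Proof. by move=> p q; rewrite mdist_integer_c00E; exact: natr_int. Qed.

End IntegerC00.

(** * Interlacing lists inside the sequence space *)

(** Adding up blocks of ones, instead of unit vectors, makes the entries count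
    the elements of [s] beyond a threshold: these counts differ by at most 1 for
    interlacing lists but by the full length for consecutive ones. *)
Definition staircase (s : seq nat) : {poly int} :=
  \sum_(a <- s) \poly_(k < a) 1.

Lemma coef_staircase s k : (staircase s)`_k = (count (ltn k) s)%:Z.
Proof.
rewrite /staircase coef_sum; elim: s => [|a s IH]; first by rewrite big_nil.
by rewrite big_cons IH coef_poly /= PoszD; case: ifP.
Qed.

Lemma interlaced_size k s t : interlaced k s t -> size s = size t.
Proof.
by elim: s k t => [|a s IH] k [|b t]//= /and3P[_ _ /IH ->].
Qed.

(** Below the starting point [j] all entries are counted in both lists; this
    clause is what the induction needs when the first entries of [s] and [t]
    are separated by [k]. *)
Lemma count_interlaced j s t k : interlaced j s t ->
  ((k <= j)%N ==> (count (ltn k) s == count (ltn k) t)) &&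
  (count (ltn k) s <= count (ltn k) t <= (count (ltn k) s).+1)%N.
Proof.
elim: s j t => [|a s IH] j [|b t]//=; first by rewrite eqxx implybT.
by move=> /and3P[ja ab /IH]; lia.
Qed.

Lemma staircase_interlaced s t : interlaced 0 s t ->
  (sup_norm (staircase s - staircase t) <= 1)%N.
Proof.
move=> st; apply: sup_norm_le => k; rewrite coefB !coef_staircase.
by have := count_interlaced k st; lia.
Qed.

Lemma staircase_le_size s t r : size s = r -> size t = r ->
  (sup_norm (staircase s - staircase t) <= r)%N.
Proof.
move=> sr tr; apply: sup_norm_le => k; rewrite coefB !coef_staircase.
by have := count_size (ltn k) s; have := count_size (ltn k) t; lia.
Qed.

Lemma path_ltn_le_last x s : path ltn x s ->
  all (fun a => a <= last x s)%N (x :: s).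
Proof.
elim: s x => [|a s IH] x /=; first by rewrite leqnn.
by move=> /andP[xa /IH /= /andP[al sl]]; rewrite al sl (leq_trans (ltnW xa)).
Qed.

Lemma staircase_far s t r : size t = r -> path ltn 0 (s ++ t) ->
  (r <= sup_norm (staircase s - staircase t))%N.
Proof.
rewrite cat_path => tr /andP[ps pt]; set k := last 0%N s in pt.
apply: leq_trans (coef_le_sup_norm _ k); rewrite coefB !coef_staircase.
have /andP[_ sk] := path_ltn_le_last ps.
have -> : count (ltn k) s = 0%N.
  apply/eqP; rewrite -leqn0 leqNgt -has_count -all_predC.
  by apply: sub_all sk => a /=; rewrite -leqNgt.
have /eqP -> : count (ltn k) t == size t.
  by rewrite -all_count; exact: (order_path_min ltn_trans pt).
by rewrite tr sub0r abszN.
Qed.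

(** * Coarse embeddings *)

Lemma coarse_embedding_comp (R : realType) (X Y : metricType R)
    (E V : normedModType R) (i : Y -> X) (f : X -> E) (j : E -> V) :
  isometric_embedding i -> (forall x y, `|j x - j y| = `|x - y|) ->
  coarse_embedding f -> coarse_embedding (j \o f \o i).
Proof.
move=> ii jj [rho1 [rho2 [c1 c2 c12 fE]]]; exists rho1, rho2; split=> // x y.
by rewrite /= jj -ii; exact: fE.
Qed.

Lemma nonprincipal_ultrafilter :
  exists U : set_system nat, UltraFilter U /\ forall k, U [set n | (k < n)%N].
Proof.
have [U [UU leU]] := ultraFilterLemma (eventually_filter : ProperFilter \oo).
by exists U; split=> // k; apply: leU; exact: nbhs_infty_gt.
Qed.

(** Interlacing lists are sent by [staircase] to points at distance at most 1,
    consecutive ones to points at distance at least their length; in a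
    reflexive target the images of the latter stay at bounded distance. *)
Lemma integer_c00_not_coarse (R : realType) (E : normedModType R)
    (f : integer_c00 R -> E) :
  reflexive_space E -> ~ coarse_embedding f.
Proof.
move=> reflE [rho1 [rho2 [[_ rho1_nd rho1_oo] [rho2_ge0 rho2_nd _] _ fE]]].
have [U [UU U_gt]] := nonprincipal_ultrafilter.
have [t0 t0_ge0 rho1_t0] := rho1_oo (2 * rho2 1 + 2).
pose r := (Num.trunc t0).+1.
have t0r : t0 <= r%:R by rewrite ltW// truncnS_gt.
pose g s : E := f (staircase s : {poly int}).
have gE s t n : (sup_norm (staircase s - staircase t) <= n)%N ->
    `|g s - g t| <= rho2 n%:R.
  move=> stn; have /andP[_ /le_trans] := fE (staircase s) (staircase t).
  apply; rewrite mdist_integer_c00E; apply: rho2_nd => //.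
  by rewrite ler_nat.
(* Lists of other lengths are sent to 0, which makes [F] bounded on all lists. *)
pose F s := if size s == r then g s else 0.
have FM s : `|F s| <= `|g (nseq r 0)| + rho2 r%:R.
  rewrite /F; case: eqP => [sr|_]; last by rewrite normr0 addr_ge0 ?rho2_ge0.
  rewrite -[g s](subrK (g (nseq r 0))) addrC (le_trans (ler_normD _ _))//.
  by rewrite lerD2l gE// staircase_le_size// size_nseq.
have FC s t : size s = r -> interlaced 0 s t -> `|F s - F t| <= rho2 1.
  move=> sr st; rewrite /F -(interlaced_size st) sr eqxx.
  by apply: (gE _ _ 1%N); exact: staircase_interlaced.
have [s [t [sr tr st]]] := interlaced_far_pair U_gt reflE FM FC.
rewrite /F sr tr eqxx leNgt => /negP; apply; apply: (lt_le_trans rho1_t0).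
have /andP[+ _] := fE (staircase s) (staircase t).
apply: le_trans; apply: rho1_nd => //.
rewrite mdist_integer_c00E (le_trans t0r)// ler_nat.
exact: staircase_far st.
Qed.

(** Constant families embed a space into its ultrapowers. *)
Lemma embedding_in_ultrapower (R : realType) (E : normedModType R) (A : Type)
    (xi : set_system A) (xiU : UltraFilter xi) :
  exists j : E -> @ultrapower R A xi xiU E,
    forall x y, `|j x - j y| = `|x - y|.
Proof.
have cstP (x : E) : (fun=> x) \in @bounded_family_pred R A E.
  by apply/bounded_family_predP; exists `|x|.
pose cst x := BoundedFamily (cstP x).
exists (fun x => \pi_(@ultrapower R A xi xiU E)%qT (cst x)) => x y.
rewrite -[cst x](subrK (cst y)) ultrapowerD addrK.
rewrite [LHS]ultrapower_normE.
by apply: ultra_seminorm_eq; exact: cvg_cst.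
Qed.

Lemma superreflexive_not_coarse (R : realType) (X : metricType R)
    (E : completeNormedModType R) (i : integer_c00 R -> X) :
  isometric_embedding i -> superreflexive E ->
  ~ exists f : X -> E, coarse_embedding f.
Proof.
move=> ii superE [f cf].
have ultra := principal_filter_ultra tt.
have [j jj] := embedding_in_ultrapower E ultra.
exact: (integer_c00_not_coarse (superE _ _ ultra) (coarse_embedding_comp ii jj cf)).
Qed.

Theorem theorem6p4 (R : realType) :
  (forall (U : metricType R) (E : completeNormedModType R),
     urysohn_space U -> superreflexive E ->
     ~ exists f : U -> E, coarse_embedding f) /\
  (forall (UZ : metricType R) (E : completeNormedModType R),
     integer_urysohn_space UZ -> superreflexive E ->
     ~ exists f : UZ -> E, coarse_embedding f).
Proof.
split=> [U E [_ _ _ univ]|UZ E [_ _ _ _ univ]] superE.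
  have [i ii] := univ _ integer_c00_separable.
  exact: superreflexive_not_coarse ii superE.
have [i ii] := univ _ integer_c00_separable integer_c00_distances.
exact: superreflexive_not_coarse ii superE.
Qed.
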